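(* Every finite-dimensional unital Jordan algebra $A$ over $\mathbb{R}$ without nilpotent elements is a direct sum of simple algebras. If $A$ is simple, then it contains $n\geq 1$ pairwise orthogonal and (pairwise) connected minimal idempotents with sum $1$.
   Context: For a Jordan algebra $A$ put $\{abc\}=(ab)c+(cb)a-(ac)b$ and, for $p,q\in A$, $\{pAq\}=\{\{paq\}: a\in A\}$. An idempotent is an element $e$ with $e^2=e$; idempotents $p,q$ are orthogonal if $pq=0$; idempotents are ordered by $e\le f$ iff $ef=e$; an idempotent is minimal if it is nonzero and minimal among the nonzero idempotents for this order. Minimal idempotents $p,q$ are called connected if $\{pAq\}\neq\{0\}$. ''Without nilpotent elements'' means that $0$ is the only element $a$ with $a^n=0$ for some $n\ge1$. *)

(* Defs.v *)
From HB Require Import structures.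
From mathcomp Require Import all_boot all_order all_algebra.
From mathcomp Require Import classical_sets reals.

Set Implicit Arguments.
Unset Strict Implicit.
Unset Printing Implicit Defensive.

Import GRing.Theory.
Local Open Scope ring_scope.

(* Being Vector structures, these algebras are finite-dimensional. *)
HB.mixin Record Vector_isJordan (K : fieldType) A of Vector K A := {
  jmul : A -> A -> A;
  jmulC : commutative jmul;
  jmulP : forall x : A, linear (jmul x);
  jmul_jordan : forall x y : A,
    jmul (jmul x y) (jmul x x) = jmul x (jmul y (jmul x x))
}.

#[short(type="jordanType")]
HB.structure Definition Jordan (K : fieldType) :=
  { A of Vector K A & Vector_isJordan K A }.

HB.mixin Record Jordan_isUnital (K : fieldType) A of Jordan K A := {
  jone : A;
  jmul1x : left_id jone (@jmul K A)
}.

#[short(type="unitalJordanType")]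
HB.structure Definition UnitalJordan (K : fieldType) :=
  { A of Jordan K A & Jordan_isUnital K A }.

Declare Scope jordan_scope.
Delimit Scope jordan_scope with J.
Local Open Scope jordan_scope.

Notation "x ∘ y" := (jmul x y) (at level 40, left associativity) : jordan_scope.

Section JordanDefs.
Variables (K : fieldType) (A : jordanType K).
Implicit Types (a b c e f p q : A) (U I : {vspace A}).

Definition jtriple a b c : A := (a ∘ b) ∘ c + (c ∘ b) ∘ a - (a ∘ c) ∘ b.

Definition is_idempotent e := e ∘ e = e.

Definition orthogonal_idem p q := p ∘ q = 0.

Definition idem_le e f := e ∘ f = e.

Definition minimal_idempotent e :=
  [/\ is_idempotent e, e <> 0
    & forall f, is_idempotent f -> f <> 0 -> idem_le f e -> f = e].

Definition connected_idem p q :=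
  range (fun a => jtriple p a q) <> [set 0]%classic.

Definition subalgebra U :=
  forall a b, a \in U -> b \in U -> a ∘ b \in U.

(* One-sided absorption suffices because the product is commutative. *)
Definition ideal_of U I :=
  (I <= U)%VS /\ forall a b, a \in U -> b \in I -> a ∘ b \in I.

(* The subspace U, with the restricted product, is a simple algebra. *)
Definition simple_algebra U :=
  [/\ subalgebra U,
      exists a b, [/\ a \in U, b \in U & a ∘ b <> 0]
    & forall I, ideal_of U I -> I = 0%VS \/ I = U].

(* An internal direct sum; distinct summands annihilate each other, since
   the product of two ideals lies in their intersection. *)
Definition direct_sum_of_simple_algebras :=
  exists (m : nat) (S : 'I_m -> {vspace A}),
    [/\ (\sum_(i < m) S i)%VS = fullv,
        directv (\sum_(i < m) S i)%VS,
        forall i, ideal_of fullv (S i)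
      & forall i, simple_algebra (S i)].

End JordanDefs.

Section UnitalJordanDefs.
Variables (K : fieldType) (A : unitalJordanType K).

(* a^0 = 1, a^1 = a and a^(n+2) = a ∘ a^(n+1). *)
Definition jpow (a : A) (n : nat) : A := iterop n (@jmul K A) a jone.

Definition without_nilpotents :=
  forall (a : A) (n : nat), (1 <= n)%N -> jpow a n = 0 -> a = 0.

End UnitalJordanDefs.

(* Main.v *)
(* The linearized Jordan identity gives the Peirce decomposition of an
   idempotent e into eigenspaces A_1, A_1/2, A_0 of multiplication by e.  Powers
   associate, so x satisfies a polynomial relation, and without nilpotents the
   relation can be divided down to x = x (x g(x)); then x g(x) is an idempotent.
   Hence every nonzero subalgebra contains a nonzero idempotent, and an ideal I
   contains an idempotent e with A_0(e) meeting I trivially.  For x in A_1/2(e)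
   the Jordan identity gives x E_1(x^2) = x E_0(x^2); as E_0(x^2) lies in I and
   so vanishes, x^3 = 0 and x = 0.  Thus A_1/2(e) = 0 and I = A_1(e) has the
   complementary ideal A_0(e), which yields the direct sum by induction.

   The unit is a sum of orthogonal minimal idempotents e_i.  Being connected is
   transitive: if x in A_ij and y in A_jk had product 0, the nonzero element
   a = e_j x^2 would annihilate y, hence so would e_j, a polynomial in a without
   constant term by minimality, contradicting e_j y = y/2.  The sum E over a
   connectedness class then has A_1/2(E) = 0, so A = A_1(E) + A_0(E) is a sum of
   ideals and simplicity forces E = 1. *)
Require Import Defs.
From HB Require Import structures.
From mathcomp Require Import all_boot all_order all_algebra.
From mathcomp Require Import boolp classical_sets reals.
From mathcomp Require Import lra.

Set Implicit Arguments.
Unset Strict Implicit.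
Unset Printing Implicit Defensive.

Import GRing.Theory Num.Theory.
Local Open Scope ring_scope.
Local Open Scope jordan_scope.

(* Testing against linear forms turns vector identities into goals for [lra]. *)
Lemma eq_scalar (K : fieldType) (V : vectType K) (u v : V) :
  (forall f : {scalar V}, f u = f v) -> u = v.
Proof.
move=> eq_uv; rewrite (coord_vbasis (memvf u)) (coord_vbasis (memvf v)).
by apply: eq_bigr => i _; rewrite (eq_uv (coord (vbasis fullv) i)).
Qed.

(** * Bilinearity and the linearized Jordan identity *)

Section JordanAlgebra.
Variables (K : realFieldType) (A : jordanType K).
Implicit Types (a b c e f p q u v w x y z : A) (U I : {vspace A}).

HB.instance Definition _ x :=
  GRing.isLinear.Build K A A *:%R (jmul x) (jmulP x).

Lemma jmul0r x : x ∘ 0 = 0. Proof. exact: linear0. Qed.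
Lemma jmulDr x y z : x ∘ (y + z) = x ∘ y + x ∘ z. Proof. exact: linearD. Qed.
Lemma jmulNr x y : x ∘ (- y) = - (x ∘ y). Proof. exact: linearN. Qed.
Lemma jmulZr (k : K) x y : x ∘ (k *: y) = k *: (x ∘ y).
Proof. exact: linearZ. Qed.
Lemma jmul0l x : 0 ∘ x = 0. Proof. by rewrite jmulC jmul0r. Qed.
Lemma jmulDl x y z : (y + z) ∘ x = y ∘ x + z ∘ x.
Proof. by rewrite jmulC jmulDr !(jmulC x). Qed.
Lemma jmulNl x y : (- y) ∘ x = - (y ∘ x).
Proof. by rewrite jmulC jmulNr (jmulC x). Qed.
Lemma jmulZl (k : K) x y : (k *: y) ∘ x = k *: (y ∘ x).
Proof. by rewrite jmulC jmulZr (jmulC x). Qed.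

Lemma jmul_sumr (I : Type) (r : seq I) (P : pred I) (F : I -> A) x :
  x ∘ (\sum_(i <- r | P i) F i) = \sum_(i <- r | P i) x ∘ F i.
Proof. exact: linear_sum. Qed.

Lemma jmul_suml (I : Type) (r : seq I) (P : pred I) (F : I -> A) x :
  (\sum_(i <- r | P i) F i) ∘ x = \sum_(i <- r | P i) F i ∘ x.
Proof. by rewrite jmulC jmul_sumr; apply: eq_bigr => i _; rewrite jmulC. Qed.

Definition jlinE :=
  (jmul0r, jmul0l, jmulDr, jmulDl, jmulNr, jmulNl, jmulZr, jmulZl).

Lemma scalar0 (f : {scalar A}) : f 0 = 0. Proof. exact: linear0. Qed.
Lemma scalarD (f : {scalar A}) u v : f (u + v) = f u + f v.
Proof. exact: linearD. Qed.
Lemma scalarN (f : {scalar A}) u : f (- u) = - f u. Proof. exact: linearN. Qed.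
Lemma scalarZ (f : {scalar A}) (k : K) u : f (k *: u) = k * f u.
Proof. exact: linearZ. Qed.
Definition scalE := (scalar0, scalarD, scalarN, scalarZ).

Lemma jordanE x w : x ∘ ((x ∘ x) ∘ w) = (x ∘ x) ∘ (x ∘ w).
Proof. by rewrite (jmulC (x ∘ x) w) -jmul_jordan jmulC. Qed.

Lemma jordan_lin x y z w :
  x ∘ ((y ∘ z) ∘ w) + y ∘ ((z ∘ x) ∘ w) + z ∘ ((x ∘ y) ∘ w) =
  (y ∘ z) ∘ (x ∘ w) + (z ∘ x) ∘ (y ∘ w) + (x ∘ y) ∘ (z ∘ w).
Proof.
apply: eq_scalar => f.
have E t := congr1 f (jordanE t w).
(* Polarization of the Jordan identity, which is cubic in t. *)
move: (E (x + y + z)) (E (x + y)) (E (x + z)) (E (y + z)) (E x) (E y) (E z).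
rewrite ?jlinE (jmulC z x) (jmulC y x) (jmulC z y) ?scalE.
lra.
Qed.
End JordanAlgebra.

(** * Peirce decomposition with respect to an idempotent *)

Section Peirce.
Variables (K : realFieldType) (A : jordanType K).
Implicit Types (a b c e f p q u v w x y z : A) (U I : {vspace A}).

Definition peirce e (k : K) : {vspace A} := lker (linfun (jmul e) - k *: \1)%VF.

Lemma peirceP e k a : reflect (e ∘ a = k *: a) (a \in peirce e k).
Proof.
rewrite memv_ker add_lfunE opp_lfunE scale_lfunE id_lfunE lfunE subr_eq0 /=.
exact: eqP.
Qed.

Lemma peirce1P e a : reflect (e ∘ a = a) (a \in peirce e 1).
Proof. by rewrite -{2}[a]scale1r; apply: peirceP. Qed.

Lemma peirce0P e a : reflect (e ∘ a = 0) (a \in peirce e 0).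
Proof. by rewrite -(scale0r a); apply: peirceP. Qed.

(** The linearized identity at [e, e, a, w] says (2k - 1)(e(aw) - a(ew)) = 0, which can be divided
    by 2k - 1 off the eigenvalue 1/2. The boolean [k] stands for the eigenvalue 0 or 1. *)
Lemma peirce_comm e (k : bool) a w : is_idempotent e -> a \in peirce e k%:R ->
  e ∘ (a ∘ w) = a ∘ (e ∘ w).
Proof.
move=> idem_e /peirceP ea; apply: eq_scalar => f.
have := congr1 f (jordan_lin e e a w).
rewrite idem_e (jmulC a e) ea.
by case: k {ea} => /=; rewrite ?scale1r ?scale0r ?jlinE ?scalE; lra.
Qed.

Lemma peirceM e (k : bool) (l : K) a b : is_idempotent e ->
  a \in peirce e k%:R -> b \in peirce e l -> a ∘ b \in peirce e l.
Proof.
move=> idem_e ea /peirceP eb; apply/peirceP.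
by rewrite (peirce_comm _ idem_e ea) eb jmulZr.
Qed.

Lemma peirce01 e a b : is_idempotent e ->
  a \in peirce e 0 -> b \in peirce e 1 -> a ∘ b = 0.
Proof.
move=> idem_e ea eb.
have /peirce1P <- : a ∘ b \in peirce e 1 by apply: (@peirceM _ false).
by apply/peirce0P; rewrite (jmulC a); apply: (@peirceM _ true).
Qed.

(** The linearized identity at [e, e, a, e]: multiplication by [e] is a root of t(t - 1)(2t - 1),
    whence the three Peirce eigenvalues. *)
Lemma peirce_cubic e a : is_idempotent e ->
  2 *: (e ∘ (e ∘ (e ∘ a))) = 3 *: (e ∘ (e ∘ a)) - e ∘ a.
Proof.
move=> idem_e; apply: eq_scalar => f; have := congr1 f (jordan_lin e e a e).
by rewrite !idem_e (jmulC a e) !(jmulC (e ∘ a) e) ?scalE; lra.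
Qed.

(** For idempotent [e] this is a quarter of the projection onto the 1/2-space: t - t^2 vanishes at 0
    and 1 and equals 1/4 at 1/2. *)
Definition peirce_half e a := e ∘ a - e ∘ (e ∘ a).

Lemma peirce_halfP e a : is_idempotent e -> peirce_half e a \in peirce e 2^-1.
Proof.
move=> idem_e; apply/peirceP/eq_scalar => f.
have := congr1 f (peirce_cubic a idem_e); rewrite /peirce_half ?jlinE ?scalE.
lra.
Qed.

Lemma peirce_add e a : is_idempotent e -> peirce e 2^-1 = 0%VS ->
  exists a1 a0, [/\ a1 \in peirce e 1, a0 \in peirce e 0 & a = a1 + a0].
Proof.
move=> idem_e half0; have := peirce_halfP a idem_e.
rewrite half0 memv0 subr_eq0 => /eqP eea.
exists (e ∘ a), (a - e ∘ a); split; last by rewrite addrC subrK.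
  exact/peirce1P.
by apply/peirce0P; rewrite ?jlinE -eea subrr.
Qed.

(** By the linearized identity at [x, x, e, e], the square of [x] has no 1/2-component. *)
Lemma peirce_half_sqr e x : is_idempotent e -> x \in peirce e 2^-1 ->
  e ∘ (x ∘ x) \in peirce e 1.
Proof.
move=> idem_e /peirceP ex; apply/peirce1P/eq_scalar => f.
have := congr1 f (jordan_lin x x e e).
rewrite idem_e (jmulC x e) !ex ?jlinE (jmulC x e) !ex.
by rewrite (jmulC (x ∘ x) e) ?jlinE ?scalE; lra.
Qed.

(** The Jordan identity for [x] and [e] reads x^3 / 2 = x(e x^2), and either hypothesis then kills
    x^3. *)
Lemma peirce_half_cube e x : is_idempotent e -> x \in peirce e 2^-1 ->
  e ∘ (x ∘ x) = 0 \/ e ∘ (x ∘ x) = x ∘ x -> x ∘ (x ∘ x) = 0.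
Proof.
move=> idem_e /peirceP ex ez; apply: eq_scalar => f.
have := congr1 f (jmul_jordan x e); rewrite !(jmulC x e) ex.
by case: ez => ->; rewrite ?jlinE ?scalE; lra.
Qed.

Lemma idem_add p q : is_idempotent p -> is_idempotent q -> p ∘ q = 0 ->
  is_idempotent (p + q).
Proof.
by rewrite /is_idempotent ?jlinE (jmulC q p) => -> -> ->; rewrite addr0 add0r.
Qed.

Lemma peirce1_addl p q : is_idempotent p -> p ∘ q = 0 ->
  (peirce p 1 <= peirce (p + q)%R 1)%VS.
Proof.
move=> idem_p /peirce0P pq; apply/subvP => a pa; apply/peirce1P.
by rewrite jmulDl (peirce01 idem_p pq pa) addr0; apply/peirce1P.
Qed.

(** Measure for the inductions that enlarge or split an idempotent: [q] lies in the larger space but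
    not in the smaller one. *)
Lemma peirce_dim_add p q : is_idempotent p -> is_idempotent q -> q <> 0 ->
  p ∘ q = 0 -> (\dim (peirce p 1) < \dim (peirce (p + q)%R 1))%N.
Proof.
move=> idem_p idem_q q0 pq; have le_pq := peirce1_addl idem_p pq.
rewrite (ltn_leqif (dimv_leqif_sup le_pq)); apply/negP => /subvP le_qp.
apply: q0; rewrite -pq; apply/esym/peirce1P/le_qp/peirce1P.
by rewrite jmulDl pq add0r.
Qed.
End Peirce.

(** * Power associativity and polynomial evaluation *)

Section Powers.
Variables (K : realFieldType) (A : unitalJordanType K).
Implicit Types (a b c e f t u v w x y z : A) (p q r : {poly K}).

Lemma jmulx1 x : x ∘ jone = x. Proof. by rewrite jmulC jmul1x. Qed.

Lemma jpowS x n : jpow x n.+1 = x ∘ jpow x n.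
Proof. by case: n => [|n]; rewrite ?jmulx1. Qed.

(** Both commutations are proved together: [step], a case of the linearized identity, expresses
    multiplication by x^(m+2) through multiplication by x, x^2, x^m and x^(m+1). *)
Lemma jpow_comm x n t :
  jpow x n ∘ (x ∘ t) = x ∘ (jpow x n ∘ t) /\
  jpow x n ∘ ((x ∘ x) ∘ t) = (x ∘ x) ∘ (jpow x n ∘ t).
Proof.
have step m u : jpow x m.+2 ∘ u =
    (x ∘ x) ∘ (jpow x m ∘ u) + 2 *: (jpow x m.+1 ∘ (x ∘ u))
    - jpow x m ∘ (x ∘ (x ∘ u)) - x ∘ (x ∘ (jpow x m ∘ u)).
  apply: eq_scalar => f; have := congr1 f (jordan_lin x (jpow x m) u x).
  rewrite (jmulC (jpow x m ∘ u) x) (jmulC u x) (jmulC (x ∘ u) x).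
  rewrite (jmulC (jpow x m) x) -jpowS (jmulC (jpow x m.+1) x) -jpowS.
  rewrite (jmulC u) (jmulC (x ∘ u)) (jmulC (jpow x m ∘ u) (x ∘ x)).
  by rewrite ?scalE; lra.
elim/ltn_ind: n t => -[|[|n]] IH t.
- by rewrite !jmul1x.
- by rewrite jordanE.
have [Cx Cxx] : (forall t, jpow x n ∘ (x ∘ t) = x ∘ (jpow x n ∘ t)) /\
    (forall t, jpow x n ∘ ((x ∘ x) ∘ t) = (x ∘ x) ∘ (jpow x n ∘ t)).
  by split=> u; have [] := IH n (ltnW (ltnSn _)) u.
have [Dx Dxx] : (forall t, jpow x n.+1 ∘ (x ∘ t) = x ∘ (jpow x n.+1 ∘ t)) /\
    (forall t, jpow x n.+1 ∘ ((x ∘ x) ∘ t) = (x ∘ x) ∘ (jpow x n.+1 ∘ t)).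
  by split=> u; have [] := IH n.+1 (ltnSn _) u.
rewrite !step; split; rewrite ?jlinE.
  by rewrite !Cx !Dx -!jordanE.
by rewrite !jordanE !Cxx !Dxx !Cx !Dx !jordanE.
Qed.

Definition jeval x p : A := \sum_(i < size p) p`_i *: jpow x i.

Lemma jevalE n x p : (size p <= n)%N ->
  jeval x p = \sum_(i < n) p`_i *: jpow x i.
Proof.
move=> le_n; rewrite /jeval -!(big_mkord xpredT (fun i => p`_i *: jpow x i)).
rewrite (big_cat_nat _ le_n) //= [X in _ = _ + X]big_nat_cond.
rewrite [X in _ = _ + X]big1 ?addr0 // => i.
by rewrite andbT => /andP[/(nth_default 0)-> _]; rewrite scale0r.
Qed.

Lemma jeval_is_linear x : linear (jeval x).
Proof.
move=> k p q; pose n := maxn (size (k *: p + q)) (maxn (size p) (size q)).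
rewrite !(@jevalE n) ?leq_max ?leqnn ?orbT //.
rewrite scaler_sumr -big_split /=; apply: eq_bigr => i _.
by rewrite coefD coefZ scalerDl scalerA.
Qed.

HB.instance Definition _ x :=
  GRing.isLinear.Build K {poly K} A *:%R (jeval x) (jeval_is_linear x).

Lemma jeval0 x : jeval x 0 = 0. Proof. exact: linear0. Qed.
Lemma jevalD x p q : jeval x (p + q) = jeval x p + jeval x q.
Proof. exact: linearD. Qed.
Lemma jevalZ x k p : jeval x (k *: p) = k *: jeval x p.
Proof. exact: linearZ. Qed.

Lemma jeval_sum (I : Type) (s : seq I) (P : pred I) (F : I -> {poly K}) x :
  jeval x (\sum_(i <- s | P i) F i) = \sum_(i <- s | P i) jeval x (F i).
Proof. exact: linear_sum. Qed.

Lemma jevalC x k : jeval x k%:P = k *: jone.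
Proof.
by rewrite (@jevalE 1) ?size_polyC ?leq_b1 // big_ord1 coefC.
Qed.

Lemma jevalMX x p : jeval x (p * 'X) = x ∘ jeval x p.
Proof.
rewrite (@jevalE (size p).+1); last first.
  by rewrite (leq_trans (size_mul_leq _ _)) // size_polyX addn2.
rewrite big_ord_recl coefMX scale0r add0r /jeval jmul_sumr.
by apply: eq_bigr => i _; rewrite coefMX jmulZr -jpowS.
Qed.

Lemma jeval_comm x p t : jeval x p ∘ (x ∘ t) = x ∘ (jeval x p ∘ t).
Proof.
rewrite !jmul_suml jmul_sumr; apply: eq_bigr => i _; rewrite !jmulZl jmulZr.
by have [->] := jpow_comm x i t.
Qed.

(** This is power associativity; in the induction on [p], [jeval_comm] pulls the factor [x] out of
    the product. *)
Lemma jevalM x p q : jeval x (p * q) = jeval x p ∘ jeval x q.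
Proof.
elim/poly_ind: p => [|p k IHp]; first by rewrite mul0r !linear0 jmul0l.
rewrite mulrDl !linearD /= jmulDl mulrAC !jevalMX IHp.
rewrite mul_polyC linearZ jevalC jmulZl jmul1x; congr (_ + _).
by rewrite [RHS]jmulC jeval_comm (jmulC (jeval x q)).
Qed.
End Powers.

(** * Idempotents and ideals in the absence of nilpotents *)

Section NoNilpotents.
Variables (K : realFieldType) (A : unitalJordanType K).
Hypothesis hA : without_nilpotents A.
Implicit Types (a b c e f t u v w x y z : A) (p q r : {poly K}).
Implicit Types (U I J : {vspace A}).

Lemma cube_eq0 x : x ∘ (x ∘ x) = 0 -> x = 0.
Proof. by move=> x3; apply: (hA (n := 3)). Qed.

Lemma jpow_jeval x p n : jpow (jeval x p) n = jeval x (p ^+ n).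
Proof.
elim: n => [|n IHn]; first by rewrite expr0 jevalC scale1r.
by rewrite jpowS IHn exprS jevalM.
Qed.

Lemma jevalXn x n : jeval x 'X^n = jpow x n.
Proof.
elim: n => [|n IHn]; first by rewrite expr0 jevalC scale1r.
by rewrite exprSr jevalMX IHn jpowS.
Qed.

Lemma exists_annihilator x : exists2 p, p != 0 & jeval x p = 0.
Proof.
pose n := \dim {:A}; pose X := [tuple jpow x i | i < n.+1].
have notfree : ~ free X.
  by rewrite /free size_tuple => /eqP dimX; have := dimvS (subvf <<X>>%VS);
    rewrite dimX ltnn.
apply: contrapT => noann; apply: notfree.
apply/freeP => k sumk i.
pose p := \poly_(i < n.+1) k (inord i).
have p0 : p = 0.
  apply/eqP/negPn/negP => pn0; apply: noann; exists p => //.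
  rewrite /p poly_def jeval_sum -[RHS]sumk; apply: eq_bigr => j _.
  by rewrite inord_val jevalZ jevalXn -tnth_nth tnth_mktuple.
by have := congr1 (fun q => q`_i) p0; rewrite coef_poly ltn_ord inord_val coef0.
Qed.

Lemma exists_local_unit x :
  exists p, is_idempotent (jeval x (p * 'X)) /\ jeval x (p * 'X) ∘ x = x.
Proof.
have [P Pn0 Px] := exists_annihilator x.
have [m [q]] := multiplicity_XsubC P 0; rewrite Pn0 subr0 /= => q0 defP.
(* Here P = q X^m with q(0) nonzero. Since P divides (q X)^(m+1), the value of q X at [x] is
   nilpotent. *)
have qx0 : jeval x (q * 'X) = 0.
  apply: (hA (n := m.+1)) => //; rewrite jpow_jeval exprMn exprS exprSr.
  by rewrite mulrACA -defP jevalM Px jmul0l.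
elim/poly_ind: q q0 qx0 {defP} => [|q c _]; first by rewrite root0.
rewrite rootE hornerMXaddC mulr0 add0r => c0.
rewrite mulrDl jevalD mul_polyC jevalZ => /eqP.
rewrite addr_eq0 => /eqP qXX.
have evX : jeval x 'X = x by rewrite -['X]mul1r jevalMX jevalC scale1r jmulx1.
(* The old q is now q X + c with c nonzero, and q(x) x^2 + c x = 0 is solved for [x]. *)
have ex : jeval x ((- c^-1 *: q) * 'X * 'X) = x.
  rewrite -!scalerAl jevalZ qXX evX scalerN scaleNr opprK scalerA.
  by rewrite mulVf ?scale1r.
exists (- c^-1 *: q); split; last by rewrite jmulC -jevalMX.
rewrite /is_idempotent -jevalM -mulrA (mulrC 'X) jevalM ex jmulC -jevalMX //.
Qed.

(** The factor ['X] removes the constant term, as [U] may not contain [jone]. *)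
Lemma jeval_mem U x p : subalgebra U -> x \in U -> jeval x (p * 'X) \in U.
Proof.
move=> algU Ux; elim/poly_ind: p => [|p c IHp].
  by rewrite mul0r jeval0 mem0v.
rewrite jevalMX jevalD jmulDr; apply: memvD; first exact: algU.
by rewrite jevalC jmulZr jmulx1 memvZ.
Qed.

Lemma exists_idem U : subalgebra U -> U <> 0%VS ->
  exists e, [/\ e \in U, is_idempotent e & e <> 0].
Proof.
move=> algU /eqP; rewrite -vpick0; set x := vpick U => x0.
have [p [idem_e ex]] := exists_local_unit x.
exists (jeval x (p * 'X)); split=> //; first by rewrite jeval_mem ?memv_pick.
by move=> e0; move: x0; rewrite -ex e0 jmul0l eqxx.
Qed.

Lemma peirce0_subalgebra e : is_idempotent e -> subalgebra (peirce e 0).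
Proof. by move=> idem_e a b ea eb; apply: (@peirceM _ _ _ false). Qed.

Lemma peirce1_subalgebra e : is_idempotent e -> subalgebra (peirce e 1).
Proof. by move=> idem_e a b ea eb; apply: (@peirceM _ _ _ true). Qed.

Lemma exists_maximal_idem U : subalgebra U ->
  exists e, [/\ e \in U, is_idempotent e & (peirce e 0 :&: U = 0)%VS].
Proof.
move=> algU.
(* Starting from [e = 0], idempotents of [U] orthogonal to [e] are added; each one lowers the
   codimension of the 1-space of [e]. *)
suff max n e : e \in U -> is_idempotent e ->
    (\dim {:A} - \dim (peirce e 1) < n)%N ->
    exists e, [/\ e \in U, is_idempotent e & (peirce e 0 :&: U = 0)%VS].
  by apply: (max _ 0); rewrite ?mem0v // /is_idempotent jmul0r.
elim: n e => // n IHn e Ue idem_e; rewrite ltnS => le_n.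
have [eU0|/eqP e0] := eqVneq (peirce e 0 :&: U)%VS 0%VS; first by exists e.
have [|f [/memv_capP[/peirce0P ef Uf] idem_f f0]] := exists_idem _ e0.
  move=> a b /memv_capP[ea Ua] /memv_capP[eb Ub]; apply/memv_capP; split.
    exact: peirce0_subalgebra.
  exact: algU.
apply: (IHn (e + f)); rewrite ?memvD //; first exact: idem_add.
apply: leq_trans le_n; rewrite ltn_sub2l ?peirce_dim_add //.
by rewrite (leq_trans (peirce_dim_add idem_e idem_f f0 ef)) ?dimvS ?subvf.
Qed.

Lemma ideal_subalgebra I : ideal_of fullv I -> subalgebra I.
Proof. by case=> _ idI a b _ Ib; apply: idI; rewrite ?memvf. Qed.

Lemma ideal_peirce I : ideal_of fullv I ->
  exists e, [/\ is_idempotent e, peirce e 2^-1 = 0%VS & I = peirce e 1].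
Proof.
move=> idlI.
have [e [Ie idem_e max_e]] := exists_maximal_idem (ideal_subalgebra idlI).
have {}idlI a b : b \in I -> a ∘ b \in I by apply: (proj2 idlI); rewrite memvf.
have rest0 a : a \in I -> e ∘ (a - e ∘ a) = 0 -> e ∘ a = a.
  move=> Ia /peirce0P ea; apply/esym/eqP; rewrite -subr_eq0 -memv0 -max_e.
  by rewrite memv_cap ea memvB ?idlI.
have half0 : peirce e 2^-1 = 0%VS.
  apply/eqP; rewrite -subv0; apply/subvP => x ex; rewrite memv0; apply/eqP.
  (* Since x = 2xe lies in [I], so does x^2 - e x^2; it is in the 0-space of [e], hence zero by the
     choice of [e]. *)
  apply: cube_eq0; apply: (peirce_half_cube idem_e ex); right.
  have Ix : x \in I.
    have -> : x = 2 *: (x ∘ e).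
      by rewrite jmulC (peirceP _ _ _ ex) scalerA divff ?scale1r ?pnatr_eq0.
    by rewrite memvZ ?idlI.
  apply: rest0; first exact: idlI.
  by rewrite jmulDr jmulNr (peirce1P _ _ (peirce_half_sqr idem_e ex)) subrr.
exists e; split=> //; apply/eqP; rewrite eqEsubv.
apply/andP; split; apply/subvP => a.
  move=> Ia; apply/peirce1P/rest0 => //.
  have [a1 [a0 [/peirce1P e1 /peirce0P e0 ->]]] := peirce_add a idem_e half0.
  by rewrite !jlinE !e0 !e1 jmul0r !addr0 subrr.
by move=> /peirce1P <-; rewrite jmulC idlI.
Qed.

Lemma peirce0_ideal e : is_idempotent e -> peirce e 2^-1 = 0%VS ->
  ideal_of fullv (peirce e 0).
Proof.
move=> idem_e half0; split=> [|a b _ eb]; first exact: subvf.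
have [a1 [a0 [ea1 ea0 ->]]] := peirce_add a idem_e half0.
rewrite jmulDl jmulC (peirce01 idem_e eb ea1) add0r.
exact: peirce0_subalgebra.
Qed.

(** [I] is the 1-space of an idempotent whose 0-space annihilates it, so only the component in [I]
    of a multiplier acts on [J]. *)
Lemma ideal_trans I J : ideal_of fullv I -> ideal_of I J -> ideal_of fullv J.
Proof.
move=> /ideal_peirce[e [idem_e half0 ->]] [sJI idlJ]; split=> [|a b _ Jb].
  exact: subvf.
have [a1 [a0 [ea1 ea0 ->]]] := peirce_add a idem_e half0.
by rewrite jmulDl (peirce01 idem_e ea0 (subvP sJI _ Jb)) addr0 idlJ.
Qed.

(** Strong induction on dimension, splitting off a proper nonzero ideal. Directness is recorded as
    additivity of dimensions, the form that [directvE] asks for. *)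
Lemma ideal_sum_simple I : ideal_of fullv I ->
  exists s : seq {vspace A}, [/\ (\sum_(U <- s) U)%VS = I,
    (\sum_(U <- s) \dim U)%N = \dim I &
    forall U, U \in s -> ideal_of fullv U /\ simple_algebra U].
Proof.
move: {2}(\dim I).+1 (ltnSn (\dim I)) => n; elim: n I => // n IHn I.
rewrite ltnS => le_n idlI; have [I0|/eqP In0] := eqVneq I 0%VS.
  by exists [::]; rewrite !big_nil I0 dimv0.
have [[J [idlJ J0 JI]]|noJ] :=
  pselect (exists J, [/\ ideal_of I J, J <> 0%VS & J <> I]); last first.
  exists [:: I]; split=> [||U]; rewrite ?big_seq1 // inE => /eqP ->.
  split=> //; split; first exact: ideal_subalgebra.
    have [e [Ie idem_e e0]] := exists_idem (ideal_subalgebra idlI) In0.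
    by exists e, e; rewrite idem_e.
  move=> J idlJ; apply: contrapT => /not_orP[J0 JI].
  by apply: noJ; exists J.
have sJI := proj1 idlJ; have {}idlJ := ideal_trans idlI idlJ.
have [f [idem_f half0 defJ]] := ideal_peirce idlJ.
(* The 0-space of [f] is an ideal complementary to [J]; its trace on [I] is the complement of [J]
   inside [I]. *)
pose J' := (I :&: peirce f 0)%VS.
have idlJ' : ideal_of fullv J'.
  split=> [|a b aA]; first exact: subvf.
  case/memv_capP=> Ib fb; apply/memv_capP; split; first exact: (proj2 idlI).
  by apply: (proj2 (peirce0_ideal idem_f half0)).
have capJ : (J :&: J' = 0)%VS.
  apply/eqP; rewrite -subv0; apply/subvP => a; rewrite defJ memv0.
  by case/memv_capP=> /peirce1P fa /memv_capP[_ /peirce0P]; rewrite fa => ->.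
have sumJ : (J + J' = I)%VS.
  apply/eqP; rewrite eqEsubv subv_add sJI capvSl /=; apply/subvP => a Ia.
  have [a1 [a0 [fa1 fa0 def_a]]] := peirce_add a idem_f half0.
  rewrite def_a memv_add ?defJ //; apply/memv_capP; split=> //.
  have -> : a0 = a - a1 by rewrite def_a addrC addKr.
  by rewrite memvB // (subvP sJI) // defJ.
have dimJ : (\dim J + \dim J' = \dim I)%N by rewrite -sumJ dimv_disjoint_sum.
have posJ : (0 < \dim J)%N by rewrite lt0n dimv_eq0; apply/eqP.
have posJ' : (0 < \dim J')%N.
  rewrite lt0n dimv_eq0; apply/eqP => J'0; apply: JI.
  by rewrite -sumJ J'0 addv0.
have [|s1 [sum1 dim1 s1P]] := IHn J _ idlJ.
  by apply: leq_trans le_n; rewrite -dimJ -addn1 leq_add2l.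
have [|s2 [sum2 dim2 s2P]] := IHn J' _ idlJ'.
  by apply: leq_trans le_n; rewrite -dimJ -add1n leq_add2r.
exists (s1 ++ s2); rewrite !big_cat /= sum1 sum2 dim1 dim2; split=> // U.
by rewrite mem_cat => /orP[/s1P|/s2P].
Qed.

Lemma unital_direct_sum : direct_sum_of_simple_algebras A.
Proof.
have [|s [sums dims sP]] := @ideal_sum_simple fullv.
  by split=> [|a b _ _]; rewrite ?subvf ?memvf.
exists (size s), (fun i => tnth (in_tuple s) i).
have inS i : tnth (in_tuple s) i \in s by apply: mem_tnth.
split; first by rewrite -[RHS]sums [RHS]big_tnth.
- by rewrite directvE /= -(big_tnth _ _ s xpredT id) sums -dims big_tnth.
- by move=> i; have [] := sP _ (inS i).
- by move=> i; have [] := sP _ (inS i).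
Qed.
End NoNilpotents.

(** * Minimal idempotents and connectedness *)

Section Minimal.
Variables (K : realFieldType) (A : unitalJordanType K).
Implicit Types (a b e f g h p q r t u v w x y z : A) (U I J : {vspace A}).

(** For orthogonal idempotents the triple product {p u q} equals 2 p(qu), so this is connectedness
    without the triple product. *)
Definition linked p q := exists u, p ∘ (q ∘ u) <> 0.

Lemma orthogonal_comm p q u : is_idempotent p -> p ∘ q = 0 ->
  p ∘ (q ∘ u) = q ∘ (p ∘ u).
Proof. by move=> idem_p /peirce0P pq; apply: (@peirce_comm _ _ p false). Qed.

Lemma linked_sym p q : is_idempotent p -> p ∘ q = 0 -> linked p q -> linked q p.
Proof. by move=> idem_p pq [u pqu]; exists u; rewrite -orthogonal_comm. Qed.

Lemma orthogonal_half p q u : is_idempotent q -> q ∘ p = 0 ->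
  p ∘ (q ∘ u) \in peirce q 2^-1.
Proof.
move=> idem_q qp; apply/peirceP; rewrite orthogonal_comm //.
(* 2 L_q^2 - L_q is the projection onto the Peirce 1-space of q. *)
have q1 : 2 *: (q ∘ (q ∘ u)) - q ∘ u \in peirce q 1.
  apply/peirce1P/eq_scalar => f; have := congr1 f (peirce_cubic u idem_q).
  by rewrite ?jlinE ?scalE; lra.
(* As [p] is in the 0-space of [q], it annihilates this 1-component, leaving 2 p(q(qu)) = p(qu). *)
have /peirce0P qp0 := qp.
apply: eq_scalar => f; have := congr1 f (peirce01 idem_q qp0 q1).
by rewrite -(orthogonal_comm _ idem_q qp) ?jlinE ?scalE
  (orthogonal_comm _ idem_q qp); lra.
Qed.

Lemma linkedP p q : is_idempotent p -> is_idempotent q -> p ∘ q = 0 ->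
  linked p q <->
  exists z, [/\ z <> 0, z \in peirce p 2^-1 & z \in peirce q 2^-1].
Proof.
move=> idem_p idem_q pq; have qp : q ∘ p = 0 by rewrite jmulC.
split=> [[u pqu]|[z [z0 /peirceP pz /peirceP qz]]].
  exists (p ∘ (q ∘ u)); split=> //; last exact: orthogonal_half.
  by rewrite orthogonal_comm //; apply: orthogonal_half.
exists z; rewrite qz jmulZr pz scalerA => /eqP.
by rewrite scaler_eq0 mulf_eq0 invr_eq0 pnatr_eq0 /= => /eqP.
Qed.

Lemma linked_connected p q : is_idempotent p -> is_idempotent q -> p ∘ q = 0 ->
  linked p q -> connected_idem p q.
Proof.
move=> idem_p idem_q pq.
move=> /(linkedP idem_p idem_q pq)[z [z0 /peirceP pz /peirceP qz]].
move=> triple0; apply: z0.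
have : [set 0]%classic (jtriple p z q) by rewrite -triple0; exists z.
rewrite /jtriple pq pz qz !jlinE (jmulC z q) (jmulC z p) pz qz => /= z4.
apply: eq_scalar => f; have := congr1 f z4; rewrite ?scalE; lra.
Qed.

(** A nonminimal [f] splits as g + (f - g), and both parts have smaller 1-spaces. Membership in
    [peirce f 1] is carried along because it makes the two resulting lists orthogonal to each
    other. *)
Lemma minimal_decomposition f : is_idempotent f ->
  exists s : seq A, [/\ forall e, e \in s -> minimal_idempotent e,
    pairwise (fun p q => p ∘ q == 0) s,
    forall e, e \in s -> e \in peirce f 1 & \sum_(e <- s) e = f].
Proof.
move: {2}(\dim (peirce f 1)).+1 (ltnSn (\dim (peirce f 1))) => n.
elim: n f => // n IHn f; rewrite ltnS => le_n idem_f.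
have [f0|/eqP f0] := eqVneq f 0; first by exists [::]; rewrite big_nil f0.
have [min_f|nmin] := pselect (minimal_idempotent f).
  exists [:: f]; rewrite big_seq1; split=> // e; rewrite inE => /eqP-> //.
  exact/peirce1P.
have [g [idem_g g0 gf /eqP fg]] :
    exists g, [/\ is_idempotent g, g <> 0, idem_le g f & g <> f].
  apply: contrapT => nog; apply: nmin; split=> // g idem_g g0 gf.
  by apply: contrapT => ngf; apply: nog; exists g.
pose h := f - g.
have idem_h : is_idempotent h.
  by rewrite /is_idempotent /h !jlinE (jmulC f g) idem_f idem_g gf subrr
    ?oppr0 ?addr0 ?subr0.
have gh : g ∘ h = 0 by rewrite /h !jlinE idem_g gf subrr.
have hg : h ∘ g = 0 by rewrite jmulC.
have def_f : f = g + h by rewrite addrC subrK.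
have h0 : h <> 0 by move/eqP; rewrite subr_eq0 eq_sym (negPf fg).
have [|s1 [min1 orth1 s1g sum1]] := IHn g _ idem_g.
  by apply: leq_trans le_n; rewrite {1}def_f peirce_dim_add.
have [|s2 [min2 orth2 s2h sum2]] := IHn h _ idem_h.
  by apply: leq_trans le_n; rewrite {1}def_f addrC peirce_dim_add.
exists (s1 ++ s2); rewrite big_cat /= sum1 sum2 -def_f; split=> //.
- by move=> e; rewrite mem_cat => /orP[/min1|/min2].
- rewrite pairwise_cat orth1 orth2 !andbT; apply/allrelP => p q s1p s2q.
  rewrite jmulC (peirce01 idem_g _ (s1g p s1p)) //.
  by apply/peirce0P/(peirce01 idem_h); [apply/peirce0P | apply: s2h].
move=> e; rewrite mem_cat => /orP[/s1g|/s2h] ef; rewrite def_f.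
  by apply: subvP ef; apply: peirce1_addl.
by rewrite addrC; apply: subvP ef; apply: peirce1_addl.
Qed.

Hypothesis hA : without_nilpotents A.

Lemma linked_trans p q r : is_idempotent p -> minimal_idempotent q ->
  is_idempotent r -> p ∘ q = 0 -> q ∘ r = 0 -> p ∘ r = 0 ->
  linked p q -> linked q r -> linked p r.
Proof.
move=> idem_p [idem_q q0 min_q] idem_r pq qr pr.
move=> /(linkedP idem_p idem_q pq)[x [x0 px qx]].
move=> /(linkedP idem_q idem_r qr)[y [y0 qy ry]].
have half_add s t z : z \in peirce s 2^-1 -> z \in peirce t 2^-1 ->
    z \in peirce (s + t) 1.
  move=> /peirceP sz /peirceP tz; apply/peirce1P; rewrite jmulDl sz tz.
  by rewrite -scalerDl (_ : _ + _ = 1) ?scale1r //; lra.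
(* [y] is in the 1-space of q + r, while [p] is in its 0-space. *)
have py : y \in peirce p 0.
  apply/peirce0P/(peirce01 (idem_add idem_q idem_r qr)); last exact: half_add.
  by apply/peirce0P; rewrite jmulC jmulDr pq pr addr0.
have rx : x \in peirce r 0.
  apply/peirce0P/(peirce01 (idem_add idem_p idem_q pq)); last exact: half_add.
  by apply/peirce0P; rewrite jmulDl pr qr addr0.
apply/(linkedP idem_p idem_r pr); exists (x ∘ y); split; last first.
- exact: (@peirceM _ _ _ false).
- by rewrite jmulC; apply: (@peirceM _ _ _ false).
move=> xy0; set a := q ∘ (x ∘ x).
have qa : a \in peirce q 1 := peirce_half_sqr idem_q qx.
have a0 : a <> 0.
  move=> a0; apply: x0; apply: (cube_eq0 hA).
  by apply: (peirce_half_cube idem_q qx); left.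
(* x^2 = p x^2 + q x^2, and the first term, in the 1-space of [p], annihilates [y]. *)
have xxy : (x ∘ x) ∘ y = a ∘ y.
  have pqx := half_add _ _ _ px qx.
  have /peirce1P <- := peirce1_subalgebra (idem_add idem_p idem_q pq) pqx pqx.
  rewrite !jmulDl (jmulC (p ∘ _) y).
  by rewrite (peirce01 idem_p py (peirce_half_sqr idem_p px)) add0r.
(* With xy = 0 the identity at [x, x, y, q] leaves ay = (x^2 y) / 2 = (ay) / 2. *)
have ay0 : a ∘ y = 0.
  apply: eq_scalar => f; have := congr1 f (jordan_lin x x y q).
  have /peirceP qy' := qy.
  rewrite (jmulC y x) xy0 !jlinE.
  rewrite (jmulC (x ∘ x) q) -/a (jmulC y q) qy' (jmulC y).
  by rewrite !jlinE xxy ?scalE; lra.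
have mul_y b : b \in peirce q 1 -> b ∘ y = 0 -> (a ∘ b) ∘ y = 0.
  move=> qb by0; apply: eq_scalar => f.
  have := congr1 f (jordan_lin a b y q).
  have /peirceP qy' := qy.
  have /peirce1P qab := peirce1_subalgebra idem_q qa qb.
  rewrite (jmulC y a) ay0 by0 (jmulC y q) qy' !jlinE.
  by rewrite (jmulC (a ∘ b) q) qab (jmulC y) ?scalE; lra.
(* The local unit of [a] is a nonzero idempotent below [q], hence is [q] itself; being a polynomial
   in [a] without constant term, it annihilates [y] by [mul_y]. *)
have [P [idem_e ea]] := exists_local_unit hA a.
have alg_q := peirce1_subalgebra idem_q.
have eq : jeval a (P * 'X) = q.
  apply: min_q => //; first by move=> e0; apply: a0; rewrite -ea e0 jmul0l.
  by rewrite /idem_le jmulC; apply/peirce1P/jeval_mem.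
have ey0 (P' : {poly K}) : jeval a (P' * 'X) ∘ y = 0.
  elim/poly_ind: P' => [|P' c IHp]; first by rewrite mul0r jeval0 jmul0l.
  rewrite jevalMX jevalD jevalC jmulDr jmulZr jmulx1.
  rewrite jmulDl jmulZl ay0 scaler0 addr0.
  by apply: mul_y => //; apply: jeval_mem.
have := ey0 P; rewrite eq; have /peirceP -> := qy => /eqP.
by rewrite scaler_eq0 invr_eq0 pnatr_eq0 => /eqP.
Qed.

Lemma simple_linked n (e : 'I_n -> A) (i j : 'I_n) :
  simple_algebra (fullv : {vspace A}) ->
  (forall k, minimal_idempotent (e k)) ->
  (forall k l, k != l -> e k ∘ e l = 0) -> \sum_k e k = jone ->
  i != j -> linked (e i) (e j).
Proof.
move=> [_ _ simpleA] min_e orth_e sum_e neq_ij; apply: contrapT => nlinked.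
have idem_e k : is_idempotent (e k) by case: (min_e k).
(* The connectedness class of [i], assumed not to contain [j]. *)
pose c k := (k == i) || `[<linked (e i) (e k)>].
pose E := \sum_(k | c k) e k.
have eE k : c k -> E ∘ e k = e k.
  move=> ck; rewrite jmul_suml (bigD1 k) //= idem_e big1 ?addr0 // => l.
  by case/andP=> _; apply: orth_e.
have idem_E : is_idempotent E.
  by rewrite /is_idempotent {2}/E jmul_sumr; apply: eq_bigr => k; apply: eE.
have Ei : E ∘ e i = e i by apply: eE; rewrite /c eqxx.
have nz (P : pred 'I_n) v : (\sum_(k | P k) e k) ∘ v <> 0 ->
    exists2 k, P k & e k ∘ v <> 0.
  move=> nz_v; apply: contrapT => nk; apply: nz_v.
  rewrite jmul_suml big1 // => k Pk.
  by apply: contrapT => ekv; apply: nk; exists k.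
have half_nz v : v <> 0 -> 2^-1 *: v <> 0.
  by move=> /eqP v0 /eqP; rewrite scaler_eq0 invr_eq0 pnatr_eq0 (negPf v0).
have half0 : peirce E 2^-1 = 0%VS.
  apply/eqP; rewrite -subv0; apply/subvP => u /peirceP Eu; rewrite memv0.
  apply/eqP; apply: contrapT => u0.
  (* Some [e k] in the class moves [u], and e_k u stays in the 1/2-space of [E], so some [e l]
     outside the class acts on it; this links [k] to [l], against transitivity. *)
  have [k ck eku] : exists2 k, c k & e k ∘ u <> 0.
    by apply: nz; rewrite Eu; apply: half_nz.
  have [l ncl eleku] : exists2 l, ~~ c l & e l ∘ (e k ∘ u) <> 0.
    apply: nz; have -> : \sum_(l | ~~ c l) e l = jone - E.
      by rewrite -sum_e [X in X - _](bigID c) /= [RHS]addrC addKr.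
    rewrite jmulDl jmul1x jmulNl (@peirce_comm _ _ E true) //; last first.
      by apply/peirce1P/eE.
    rewrite Eu jmulZr -{1}[e k ∘ u]scale1r -scalerBl.
    by rewrite (_ : _ - _ = 2^-1); [apply: half_nz | lra].
  have neq_lk : l != k by apply: contraNneq ncl => ->.
  have link_kl : linked (e k) (e l).
    by apply: linked_sym; rewrite ?orth_e //; exists u.
  move: ncl; rewrite negb_or => /andP[neq_li /asboolP]; apply.
  case/orP: ck => [/eqP <- //|/asboolP link_ik].
  have [<- //|neq_ki] := eqVneq k i.
  apply: (linked_trans (idem_e i) (min_e k) (idem_e l)) link_ik link_kl;
    by rewrite orth_e // eq_sym.
(* A zero 0-space gives E = 1, so that e_j = E e_j = 0; a full one gives e_i = E e_i = 0. *)
have [E0|E0] := simpleA _ (peirce0_ideal idem_E half0).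
  have : jone - E \in peirce E 0.
    by apply/peirce0P; rewrite jmulDr jmulx1 jmulNr idem_E subrr.
  rewrite E0 memv0 subr_eq0 => /eqP E1.
  have [_ ej0 _] := min_e j; apply: ej0; rewrite -[e j]jmul1x E1 jmul_suml.
  rewrite big1 // => k; have [->|neq_kj _] := eqVneq k j; last exact: orth_e.
  by rewrite /c eq_sym (negPf neq_ij) => /asboolP.
have [_ ei0 _] := min_e i; apply: ei0.
have : e i \in peirce E 0 by rewrite E0 memvf.
by move/peirce0P; rewrite Ei.
Qed.

End Minimal.

Theorem theorem3p3 (R : realType) (A : unitalJordanType R)
    (hA : without_nilpotents A) :
  direct_sum_of_simple_algebras A /\
  (simple_algebra (fullv : {vspace A}) ->
   exists (n : nat) (e : 'I_n -> A),
     [/\ (1 <= n)%N,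
         forall i, minimal_idempotent (e i),
         forall i j, i != j -> orthogonal_idem (e i) (e j),
         forall i j, i != j -> connected_idem (e i) (e j)
       & \sum_(i < n) e i = jone]).
Proof.
split=> [|simpleA]; first exact: unital_direct_sum.
have [s [min_s orth_s _ sum_s]] := minimal_decomposition (jmul1x (jone : A)).
pose e (i : 'I_(size s)) := s`_i.
have min_e i : minimal_idempotent (e i) by apply/min_s/mem_nth.
have idem_e i : is_idempotent (e i) by case: (min_e i).
have orth_e i j : i != j -> e i ∘ e j = 0.
  wlog lt_ij : i j / (i < j)%N => [wlog_e|_].
    rewrite neq_ltn => /orP[lt_ij|lt_ji].
      by apply: wlog_e; rewrite // neq_ltn lt_ij.
    by rewrite jmulC; apply: wlog_e; rewrite // neq_ltn lt_ji.
  by apply/eqP; apply: (pairwiseP 0 orth_s); rewrite ?inE.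
have sum_e : \sum_i e i = jone by rewrite -sum_s (big_nth 0) big_mkord.
exists (size s), e; split=> //.
  have [_ [a [b [_ _ ab0]]] _] := simpleA.
  case: (s) sum_s => // /esym; rewrite big_nil => one0.
  by case: ab0; rewrite -[a]jmul1x one0 !jmul0l.
move=> i j neq_ij; apply: linked_connected => //; first exact: orth_e.
exact: (simple_linked hA simpleA min_e orth_e).
Qed.
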